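(* Let $G=(V,E)$ be a $(q+1,q)$-graph with $q\ge1$. The following are equivalent: (i) $G$ admits a $1$-super graceful labeling whose edge-label set is $[1,q]$; (ii) $G$ is graceful; (iii) $G$ admits a $1$-super graceful labeling in which all vertices receive odd labels.
   Context: All graphs are simple, finite, undirected and without isolated vertices; a $(p,q)$-graph has $p$ vertices and $q$ edges. For integers $a\le b$, $[a,b]$ is the set of integers between $a$ and $b$ inclusive. For $k\ge 1$, a $k$-super graceful labeling of a $(p,q)$-graph $G=(V,E)$ is a bijection $f:V\cup E\to[k,k+p+q-1]$ with $f(uv)=|f(u)-f(v)|$ for every edge $uv$. A graceful labeling of $G$ is an injective map $g:V\to[0,q]$ such that the induced edge labels $|g(u)-g(v)|$, $uv\in E$, are pairwise distinct; $G$ is graceful if it has one. *)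

(* Defs.v *)
From mathcomp Require Import all_boot all_order all_algebra.

Set Implicit Arguments.
Unset Strict Implicit.
Unset Printing Implicit Defensive.

Record sgraph := SGraph {
  vertex :> finType;
  adj : rel vertex;
  adj_sym : symmetric adj;
  adj_irrefl : irreflexive adj
}.

Definition no_isolated (G : sgraph) : Prop :=
  forall u : G, exists v : G, adj u v.

Definition edges (G : sgraph) : {set {set G}} :=
  [set [set p.1; p.2] | p : G * G & adj p.1 p.2].

Definition edge (G : sgraph) : Type := {d : {set G} | d \in edges G}.

Definition pq_graph (p q : nat) (G : sgraph) : Prop :=
  #|G| = p /\ #|edges G| = q.

(* [vertex G + edge G] is the disjoint union of V and E. The last label is
   k + p + q - 1, so the upper bound is strict. *)
Definition super_graceful_labeling (k : nat) (G : sgraph)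
    (f : vertex G + edge G -> nat) : Prop :=
  [/\ injective f,
      forall n : nat,
        (exists x, f x = n) <-> k <= n < k + #|G| + #|edges G|
    & forall (d : edge G) (u v : G), val d = [set u; v] ->
        f (inr d) = `|f (inl u) - f (inl v)|%N].

Definition graceful_labeling (G : sgraph) (g : G -> nat) : Prop :=
  [/\ injective g,
      forall v : G, g v <= #|edges G|
    & forall u v u' v' : G, adj u v -> adj u' v' ->
        `|g u - g v|%N = `|g u' - g v'|%N -> [set u; v] = [set u'; v']].

Definition graceful (G : sgraph) : Prop :=
  exists g : G -> nat, graceful_labeling g.

(* Main.v *)
Require Import Defs.
From mathcomp Require Import all_boot all_order all_algebra.
From mathcomp Require Import zify.

(** A graceful labeling [g] of a graph with [q + 1] vertices and [q] edges is
    onto [[0, q]], and its edge labels fill [[1, q]].  Labeling the vertices by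
    [g + q + 1] keeps the edge labels and moves the vertex labels to
    [[q + 1, 2 q + 1]]; labeling them by [2 g + 1] doubles the edge labels, so
    that vertices take the odd and edges the even labels of [[1, 2 q + 1]].
    Both transformations are reversible. *)

(** Pigeonhole: the values of [f] form a duplicate-free list inside [iota k #|T|] of the same
    length, so the two have the same elements. Surjectivity of a labeling thus reduces to bounds. *)
Lemma injective_interval_onto (T : finType) (k : nat) (f : T -> nat) :
  injective f -> (forall x, k <= f x < k + #|T|) ->
  forall n, (exists x, f x = n) <-> k <= n < k + #|T|.
Proof.
move=> injf rgf n; split=> [[x <-] //|rgn].
have uniqf : uniq (map f (enum T)) by rewrite map_inj_uniq ?enum_uniq.
have subf : {subset map f (enum T) <= iota k #|T|}.
  by move=> _ /mapP[x _ ->]; rewrite mem_iota.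
have szf : size (iota k #|T|) <= size (map f (enum T)).
  by rewrite size_iota size_map -cardE.
have [_ eqf] := uniq_min_size uniqf subf szf.
have : n \in map f (enum T) by rewrite eqf mem_iota.
by case/mapP=> x _ ->; exists x.
Qed.

Lemma card_edge (G : sgraph) : #|{: {d : {set G} | d \in edges G}}| = #|edges G|.
Proof. by rewrite card_sig; apply: eq_card. Qed.

Lemma edge_ends (G : sgraph) (d : edge G) :
  exists p : G * G, adj p.1 p.2 && (val d == [set p.1; p.2]).
Proof.
have /imsetP[p] := valP d; rewrite inE => adjp dE.
by exists p; rewrite adjp dE /=.
Qed.

Lemma edge_of_adj (G : sgraph) (u v : G) :
  adj u v -> exists d : edge G, val d = [set u; v].
Proof.
move=> adjuv; have uvE : [set u; v] \in edges G.
  by apply/imsetP; exists (u, v); rewrite ?inE.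
by exists (exist (fun d => d \in edges G) _ uvE).
Qed.

Lemma set2_inj (T : finType) (u v u' v' : T) :
  [set u; v] = [set u'; v'] -> (u = u' /\ v = v') \/ (u = v' /\ v = u').
Proof.
move=> /setP E.
(* In the cases where [u] and [v] equal the same end, the remaining memberships force [u' = v']. *)
move: (E u) (E v) (E u') (E v'); rewrite !inE !eqxx /= !orbT.
move=> /esym/orP[]/eqP-> /esym/orP[]/eqP->; rewrite ?eqxx /= ?orbb.
- by move=> _ /eqP->; left.
- by left.
- by right.
- by move=> /eqP->; left.
Qed.

(** An edge is an unordered pair, so an ordering of its ends is chosen; the symmetry of the distance
    makes the value independent of that choice. *)
Definition edge_diff (G : sgraph) (h : G -> nat) (d : edge G) : nat :=
  let p := xchoose (edge_ends G d) in `|h p.1 - h p.2|%N.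

Lemma edge_diffE (G : sgraph) (h : G -> nat) (d : edge G) (u v : G) :
  val d = [set u; v] -> edge_diff G h d = `|h u - h v|%N.
Proof.
move=> dE; rewrite /edge_diff; set p := xchoose _.
have /andP[_ /eqP] : adj p.1 p.2 && (val d == [set p.1; p.2]).
  exact: (xchooseP (edge_ends G d)).
by rewrite dE => /set2_inj[] [-> ->] //; rewrite distnC.
Qed.

Definition total_labeling (G : sgraph) (h : G -> nat)
    (x : vertex G + edge G) : nat :=
  match x with inl v => h v | inr d => edge_diff G h d end.

Lemma edge_diff_inj (G : sgraph) (h : G -> nat) :
  (forall u v u' v' : G, adj u v -> adj u' v' ->
     `|h u - h v|%N = `|h u' - h v'|%N -> [set u; v] = [set u'; v']) ->
  injective (edge_diff G h).
Proof.
move=> hE d d'.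
have [[u v] /= /andP[adjuv /eqP dE]] := edge_ends G d.
have [[u' v'] /= /andP[adjuv' /eqP dE']] := edge_ends G d'.
rewrite (edge_diffE _ _ _ _ _ dE) (edge_diffE _ _ _ _ _ dE') => /hE E.
by apply: val_inj; apply: etrans dE (etrans _ (esym dE')); apply: E.
Qed.

(** Vertex labels are distinct, edge labels are distinct, and the last hypothesis keeps the two
    kinds apart; being as many as the integers of the interval, they fill it. Both constructions
    from a graceful labeling go through this criterion. *)
Lemma total_labeling_super_graceful (G : sgraph) (k : nat) (h : G -> nat) :
  injective h ->
  (forall u v u' v' : G, adj u v -> adj u' v' ->
     `|h u - h v|%N = `|h u' - h v'|%N -> [set u; v] = [set u'; v']) ->
  (forall v, k <= h v < k + #|G| + #|edges G|) ->
  (forall u v, adj u v -> k <= `|h u - h v|%N < k + #|G| + #|edges G|) ->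
  (forall w u v, adj u v -> h w <> `|h u - h v|%N) ->
  super_graceful_labeling k (total_labeling G h).
Proof.
move=> injh hE hV rgE hVE.
have dP (d : edge G) : exists u v, adj u v /\ edge_diff G h d = `|h u - h v|%N.
  have [[u v] /= /andP[adjuv /eqP dE]] := edge_ends G d.
  by exists u, v; split=> //; apply: edge_diffE.
have injf : injective (total_labeling G h).
  move=> [v|d] [v'|d'] /= E.
  - by rewrite (injh _ _ E).
  - by have [u' [v' [adjuv' dE]]] := dP d'; case: (hVE v u' v') => //; rewrite E.
  - by have [u [v [adjuv dE]]] := dP d; case: (hVE v' u v) => //; rewrite -E.
  - by rewrite (edge_diff_inj _ _ hE _ _ E).
split=> // [n|d u v]; last exact: edge_diffE.
have cardVE : #|{: vertex G + {d : {set G} | d \in edges G}}| = #|G| + #|edges G|.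
  by rewrite card_sum card_edge.
rewrite -addnA -cardVE; apply: injective_interval_onto => // -[v|d] /=.
  by rewrite cardVE addnA.
by have [u [v [adjuv ->]]] := dP d; rewrite cardVE addnA; apply: rgE.
Qed.

(** Each difference is the label of an edge, and [f] is injective on edges. This gives the
    distinctness of edge labels when returning to a graceful labeling. *)
Lemma super_graceful_edge_inj (k : nat) (G : sgraph)
    (f : vertex G + edge G -> nat) (u v u' v' : G) :
  super_graceful_labeling k f -> adj u v -> adj u' v' ->
  `|f (inl u) - f (inl v)|%N = `|f (inl u') - f (inl v')|%N ->
  [set u; v] = [set u'; v'].
Proof.
move=> [injf _ fE] /edge_of_adj[d dE] /edge_of_adj[d' dE'].
rewrite -(fE _ _ _ dE) -(fE _ _ _ dE') => /injf[] E.
by rewrite -dE -dE' E.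
Qed.

Lemma graceful_edge_bounds (G : sgraph) (g : G -> nat) (u v : G) :
  graceful_labeling g -> adj u v -> 1 <= `|g u - g v|%N <= #|edges G|.
Proof.
move=> [injg gV _] adjuv.
have : g u <> g v by move/injg=> E; rewrite E adj_irrefl in adjuv.
by have := gV u; have := gV v; lia.
Qed.

Theorem theorem2p9 (G : sgraph) (q : nat) (hq : 1 <= q)
    (hiso : no_isolated G) (hG : pq_graph q.+1 q G) :
  ((exists f : vertex G + edge G -> nat,
      super_graceful_labeling 1 f /\
      (forall n : nat, (exists d : edge G, f (inr d) = n) <-> 1 <= n <= q))
   <-> graceful G)
  /\
  (graceful G <->
   (exists f : vertex G + edge G -> nat,
      super_graceful_labeling 1 f /\ (forall v : G, odd (f (inl v))))).
Proof.
have [cardV cardE] := hG.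
split; split.
- move=> [f [sgf fE]]; have [injf rgf _] := sgf.
  (* The edges use up all of [[1, q]], so injectivity pushes every vertex label above [q]; hence the
     truncated subtraction of [q.+1] below loses nothing. *)
  have fV v : q < f (inl v) <= q.*2.+1.
    have : 1 <= f (inl v) < 1 + #|G| + #|edges G| by apply/rgf; exists (inl v).
    have : ~ 1 <= f (inl v) <= q by move/fE=> [d /injf].
    by rewrite cardV cardE; lia.
  exists (fun v => f (inl v) - q.+1); split.
  + move=> u v E; have /injf[] // : f (inl u) = f (inl v).
    by have := fV u; have := fV v; lia.
  + by move=> v; have := fV v; rewrite cardE; lia.
  + move=> u v u' v' adjuv adjuv' E.
    apply: (super_graceful_edge_inj _ _ _ _ _ _ _ sgf) => //.
    by have := fV u; have := fV v; have := fV u'; have := fV v'; lia.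
- move=> [g gg]; have [injg gV gE] := gg.
  have gB u v := graceful_edge_bounds _ _ u v gg.
  (* The shift puts vertex labels above [q], whereas edge labels stay at most [q], so they cannot
     collide. *)
  pose h v := g v + q.+1.
  have hE u v : `|h u - h v|%N = `|g u - g v|%N by rewrite /h; lia.
  have hI u v u' v' : adj u v -> adj u' v' ->
      `|h u - h v|%N = `|h u' - h v'|%N -> [set u; v] = [set u'; v'].
    by rewrite !hE; apply: gE.
  exists (total_labeling G h); split.
    apply: total_labeling_super_graceful => //.
    + by move=> u v /addIn/injg.
    + by move=> v; have := gV v; rewrite /h cardV cardE; lia.
    + by move=> u v /gB; rewrite hE cardV cardE; lia.
    + by move=> w u v /gB; rewrite hE /h cardE; lia.
  (* The [q] distinct edge labels lie in [[1, q]], hence exhaust it. *)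
  move=> n; rewrite -[n <= q]/(n < 1 + q) -cardE -card_edge.
  apply: injective_interval_onto; first exact: edge_diff_inj.
  move=> d /=; have [[u v] /= /andP[adjuv /eqP dE]] := edge_ends G d.
  by rewrite (edge_diffE _ _ _ _ _ dE) hE card_edge; apply: gB.
- move=> [g gg]; have [injg gV gE] := gg.
  have gB u v := graceful_edge_bounds _ _ u v gg.
  (* Vertex labels become odd and edge labels even, so parity separates them. *)
  pose h v := (g v).*2.+1.
  have hE u v : `|h u - h v|%N = (`|g u - g v|%N).*2 by rewrite /h; lia.
  exists (total_labeling G h); split; last by move=> v /=; rewrite odd_double.
  apply: total_labeling_super_graceful.
  + by move=> u v [] /double_inj/injg.
  + by move=> u v u' v' adjuv adjuv'; rewrite !hE => /double_inj; apply: gE.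
  + by move=> v; have := gV v; rewrite /h cardV cardE; lia.
  + by move=> u v /gB; rewrite hE cardV cardE; lia.
  + by move=> w u v _; rewrite hE /h; lia.
- move=> [f [sgf fO]]; have [injf rgf _] := sgf.
  (* Oddness makes halving reversible: it stays injective, maps [[1, 2 q + 1]] into [[0, q]] and
     exactly halves every difference. *)
  have fV v : f (inl v) = ((f (inl v))./2).*2.+1.
    by rewrite -[LHS]odd_double_half fO.
  exists (fun v => (f (inl v))./2); split.
  + by move=> u v E; have /injf[] // : f (inl u) = f (inl v); rewrite fV E -fV.
  + move=> v.
    have : 1 <= f (inl v) < 1 + #|G| + #|edges G| by apply/rgf; exists (inl v).
    by rewrite cardV cardE; lia.
  + move=> u v u' v' adjuv adjuv' E.
    apply: (super_graceful_edge_inj _ _ _ _ _ _ _ sgf) => //.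
    by have := fV u; have := fV v; have := fV u'; have := fV v'; lia.
Qed.
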